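(* Let $G$ be a $K_4$-free graph with $n$ vertices and $e$ edges, and put $k = e - n^2/4$. Then $G$ contains at least $\lceil k\rceil$ pairwise edge-disjoint triangles.
   Context: A graph is $K_4$-free if it contains no complete subgraph on $4$ vertices. Triangles are edge-disjoint if no edge of $G$ belongs to two of them. The value $k$ is a real number (possibly non-integer or non-positive). *)

(* Defs.v *)
From HB Require Import structures.
From mathcomp Require Import all_boot all_order all_algebra.
Set Implicit Arguments. Unset Strict Implicit. Unset Printing Implicit Defensive.
Import Order.TTheory GRing.Theory Num.Theory.

(* A finite simple graph: vertex type V : finType, adjacency g : rel V,
   assumed symmetric and irreflexive in the theorem. *)

Definition edges (V : finType) (g : rel V) : {set {set V}} :=
  [set E : {set V} | [exists x, exists y, (g x y) && (E == [set x; y])]].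

Definition K4_free (V : finType) (g : rel V) : Prop :=
  forall a b c d : V,
    ~ (g a b /\ g a c /\ g a d /\ g b c /\ g b d /\ g c d).

(* Triangles: vertex sets {x,y,z} of three pairwise adjacent vertices
   (irreflexivity makes them distinct). *)
Definition triangles (V : finType) (g : rel V) : {set {set V}} :=
  [set T : {set V} | [exists x, exists y, exists z,
     [&& g x y, g y z, g x z & T == [set x; y; z]]]].

(* Two triangles are edge-disjoint iff they share at most one vertex. *)
Definition edge_disjoint_triangles (V : finType) (g : rel V) (F : {set {set V}}) : Prop :=
  F \subset triangles g /\
  forall T1 T2, T1 \in F -> T2 \in F -> T1 != T2 -> #|T1 :&: T2| <= 1.

(* Main.v *)
Require Import Defs.
From HB Require Import structures.
From mathcomp Require Import all_boot all_order all_algebra.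
From mathcomp Require Import ring lra zify.
Import Order.TTheory GRing.Theory Num.Theory.

(* Partition the vertices greedily into m cliques: first a maximal family of
   disjoint triangles, then a maximal matching of the rest, then single vertices.
   The common neighbourhood of an edge is independent, so it meets every clique of
   the partition at most once. Colouring a triangle by the sum modulo m of the
   indices of the cliques of its vertices therefore gives distinct colours to
   triangles sharing an edge, and some colour class contains t / m of the t
   triangles. It remains to show t >= m (e - n^2/4).

   Both sides make sense for sequences of vertices with repetitions (repeated
   vertices being nonadjacent twins), and the inequality is proved by deleting the
   two ends of an edge uv. The deletion changes t - m (e - n^2/4) by a sum, over
   pairs of remaining cliques, of terms that depend only on the adjacencies between
   the two cliques, u and v; those are bounded by enumerating all the patterns.
   This removes the edges of the matching. Then t - m (e - n^2/4) is affine in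
   the multiset of single vertices, so that one may assume that these are all
   copies of one vertex s. If a triangle 123 has s adjacent to 1 and 2, one
   deletes {s, 1} and then {2, 3}. If no triangle is of this form, s has small
   degree and the Moon-Moser bound for the triangles suffices. *)

Set Implicit Arguments.
Unset Strict Implicit.
Unset Printing Implicit Defensive.

(* The booleans tell whether a vertex is adjacent to u and to v: A is "to v only",
   C is "to u only", Z is "to both" and O is "to neither". *)
Definition nA (u v : bool) : nat := ~~ u && v.
Definition nC (u v : bool) : nat := u && ~~ v.
Definition nZ (u v : bool) : nat := u && v.
Definition nO (u v : bool) : nat := ~~ u && ~~ v.

(* The pair of adjacent vertices (x true) lies neither in N(u) nor in N(v). *)
Definition uncovered (u v u' v' x : bool) : nat := [&& x, ~~ (u && u') & ~~ (v && v')].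

(** * Exhaustive checks of the adjacency patterns around an edge uv *)

Definition allb (f : bool -> bool) := f true && f false.

Lemma allbP f : allb f -> forall b, f b.
Proof. by case/andP=> ? ? []. Qed.

(** Excludes the K4s spanned by the edge uv and a triangle 123: u or v joined to all of 123, or both
    joined to the same two of its vertices. *)
Definition labels_ok (u1 u2 u3 v1 v2 v3 : bool) :=
  [&& ~~ [&& u1, u2 & u3], ~~ [&& v1, v2 & v3], ~~ [&& u1, v1, u2 & v2],
      ~~ [&& u1, v1, u3 & v3] & ~~ [&& u2, v2, u3 & v3]].
(** Excludes a K4 made of a vertex and a triangle; [rows_ok] excludes those made of an edge and two
    vertices of a triangle. *)
Definition row_ok (x y z : bool) := ~~ [&& x, y & z].
Definition rows_ok (x1 x2 x3 y1 y2 y3 : bool) :=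
  [&& ~~ [&& x1, x2, y1 & y2], ~~ [&& x1, x3, y1 & y3] & ~~ [&& x2, x3, y2 & y3]].

(** This is [balance_TT] halved: with 9 vertex pairs and w the last summand,
    [1 - 2w <= 9 + 2(O + O' - Z - Z' - cross)] becomes [cross + Z + Z' <= 4 + O + O' + w]. *)
Definition triangles_concl (u1 u2 u3 v1 v2 v3 w1 w2 w3 r1 r2 r3 : bool)
  (x11 x12 x13 x21 x22 x23 x31 x32 x33 : bool) :=
  let A := nA u1 v1 + (nA u2 v2 + nA u3 v3) in
  let C := nC u1 v1 + (nC u2 v2 + nC u3 v3) in
  let Z := nZ u1 v1 + (nZ u2 v2 + nZ u3 v3) in
  let O := nO u1 v1 + (nO u2 v2 + nO u3 v3) in
  let A' := nA w1 r1 + (nA w2 r2 + nA w3 r3) in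
  let C' := nC w1 r1 + (nC w2 r2 + nC w3 r3) in
  let Z' := nZ w1 r1 + (nZ w2 r2 + nZ w3 r3) in
  let O' := nO w1 r1 + (nO w2 r2 + nO w3 r3) in
  uncovered u1 v1 w1 r1 x11 + (uncovered u1 v1 w2 r2 x12 + uncovered u1 v1 w3 r3 x13) +
  (uncovered u2 v2 w1 r1 x21 + (uncovered u2 v2 w2 r2 x22 + uncovered u2 v2 w3 r3 x23) +
  (uncovered u3 v3 w1 r1 x31 + (uncovered u3 v3 w2 r2 x32 + uncovered u3 v3 w3 r3 x33))) + Z + Z' <=
  4 + O + O' + (A * Z * O * (C' * Z' * O') + C * Z * O * (A' * Z' * O')).

(** Each [if] discards a branch as soon as the values chosen so far contain a K4, which cuts down
    the enumeration. *)
Definition triangles_check :=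
  allb (fun u1 => allb (fun u2 => allb (fun u3 =>
  allb (fun v1 => allb (fun v2 => allb (fun v3 =>
  if ~~ labels_ok u1 u2 u3 v1 v2 v3 then true else
  allb (fun w1 => allb (fun w2 => allb (fun w3 =>
  allb (fun r1 => allb (fun r2 => allb (fun r3 =>
  if ~~ labels_ok w1 w2 w3 r1 r2 r3 then true else
  allb (fun x11 => allb (fun x12 => allb (fun x13 =>
  if ~~ row_ok x11 x12 x13 then true else
  allb (fun x21 => allb (fun x22 => allb (fun x23 =>
  if ~~ (row_ok x21 x22 x23 && rows_ok x11 x12 x13 x21 x22 x23) then true else
  allb (fun x31 => allb (fun x32 => allb (fun x33 =>
  if ~~ [&& row_ok x31 x32 x33, rows_ok x11 x12 x13 x31 x32 x33,
            rows_ok x21 x22 x23 x31 x32 x33,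
            row_ok x11 x21 x31, row_ok x12 x22 x32 & row_ok x13 x23 x33]
  then true else
  triangles_concl u1 u2 u3 v1 v2 v3 w1 w2 w3 r1 r2 r3 x11 x12 x13 x21 x22 x23 x31 x32 x33
  ))))))))))))))))))))).

(* The kernel runs through all adjacency patterns of two triangles and an edge uv
   that contain no K4. *)
Lemma triangles_checkT : triangles_check.
Proof. by vm_cast_no_check (erefl true). Qed.

Lemma triangles_local u1 u2 u3 v1 v2 v3 w1 w2 w3 r1 r2 r3 x11 x12 x13 x21 x22 x23 x31 x32 x33 :
  labels_ok u1 u2 u3 v1 v2 v3 -> labels_ok w1 w2 w3 r1 r2 r3 ->
  row_ok x11 x12 x13 -> row_ok x21 x22 x23 -> row_ok x31 x32 x33 ->
  row_ok x11 x21 x31 -> row_ok x12 x22 x32 -> row_ok x13 x23 x33 ->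
  rows_ok x11 x12 x13 x21 x22 x23 -> rows_ok x11 x12 x13 x31 x32 x33 ->
  rows_ok x21 x22 x23 x31 x32 x33 ->
  triangles_concl u1 u2 u3 v1 v2 v3 w1 w2 w3 r1 r2 r3 x11 x12 x13 x21 x22 x23 x31 x32 x33.
Proof.
move=> hP hQ r1ok r2ok r3ok c1ok c2ok c3ok k12 k13 k23.
move: triangles_checkT => /allbP/(_ u1)/allbP/(_ u2)/allbP/(_ u3).
move=> /allbP/(_ v1)/allbP/(_ v2)/allbP/(_ v3); rewrite hP.
move=> /allbP/(_ w1)/allbP/(_ w2)/allbP/(_ w3).
move=> /allbP/(_ r1)/allbP/(_ r2)/allbP/(_ r3); rewrite hQ.
move=> /allbP/(_ x11)/allbP/(_ x12)/allbP/(_ x13); rewrite r1ok.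
move=> /allbP/(_ x21)/allbP/(_ x22)/allbP/(_ x23); rewrite r2ok k12.
move=> /allbP/(_ x31)/allbP/(_ x32)/allbP/(_ x33).
by rewrite r3ok c1ok c2ok c3ok k13 k23.
Qed.

Definition triangle_edge_lhs (u1 u2 u3 v1 v2 v3 w1 w2 r1 r2 x11 x12 x21 x22 x31 x32 : bool) :=
  uncovered u1 v1 w1 r1 x11 + uncovered u1 v1 w2 r2 x12 +
  (uncovered u2 v2 w1 r1 x21 + uncovered u2 v2 w2 r2 x22 +
  (uncovered u3 v3 w1 r1 x31 + uncovered u3 v3 w2 r2 x32)) +
  (nZ u1 v1 + (nZ u2 v2 + nZ u3 v3)).

(** The first bound serves an edge y1y2 with no triangle among u, v, y1, y2 ([balance_TE]). The
    second serves the labels Z for y1 and A for y2, which occur when v, y1, y2 form a triangle that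
    is being broken up ([balance_Tpair]). *)
Definition triangle_edge_check :=
  allb (fun u1 => allb (fun u2 => allb (fun u3 =>
  allb (fun v1 => allb (fun v2 => allb (fun v3 =>
  if ~~ labels_ok u1 u2 u3 v1 v2 v3 then true else
  let O := nO u1 v1 + (nO u2 v2 + nO u3 v3) in
  allb (fun x11 => allb (fun x21 => allb (fun x31 =>
  if ~~ row_ok x11 x21 x31 then true else
  allb (fun x12 => allb (fun x22 => allb (fun x32 =>
  if ~~ row_ok x12 x22 x32 then true else
  allb (fun w1 => allb (fun w2 => allb (fun r1 => allb (fun r2 =>
  [|| w1 && w2, r1 && r2, w1 && r1, w2 && r2 |
   triangle_edge_lhs u1 u2 u3 v1 v2 v3 w1 w2 r1 r2 x11 x12 x21 x22 x31 x32
     <= 3 + O + (nO w1 r1 + nO w2 r2)])))) &&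
  (triangle_edge_lhs u1 u2 u3 v1 v2 v3 true false true true x11 x12 x21 x22 x31 x32
     <= 2 + O + O)
  )))))))))))).

Lemma triangle_edge_checkT : triangle_edge_check.
Proof. by vm_cast_no_check (erefl true). Qed.

Lemma triangle_edge_local u1 u2 u3 v1 v2 v3 x11 x12 x21 x22 x31 x32 :
  labels_ok u1 u2 u3 v1 v2 v3 -> row_ok x11 x21 x31 -> row_ok x12 x22 x32 ->
  let O := nO u1 v1 + (nO u2 v2 + nO u3 v3) in
  (forall w1 w2 r1 r2,
    ~~ (w1 && w2) -> ~~ (r1 && r2) -> ~~ (w1 && r1) -> ~~ (w2 && r2) ->
    triangle_edge_lhs u1 u2 u3 v1 v2 v3 w1 w2 r1 r2 x11 x12 x21 x22 x31 x32
      <= 3 + O + (nO w1 r1 + nO w2 r2)) /\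
  triangle_edge_lhs u1 u2 u3 v1 v2 v3 true false true true x11 x12 x21 x22 x31 x32 <= 2 + O + O.
Proof.
move=> hP c1ok c2ok.
move: triangle_edge_checkT => /allbP/(_ u1)/allbP/(_ u2)/allbP/(_ u3).
move=> /allbP/(_ v1)/allbP/(_ v2)/allbP/(_ v3); rewrite hP.
move=> /allbP/(_ x11)/allbP/(_ x21)/allbP/(_ x31); rewrite c1ok.
move=> /allbP/(_ x12)/allbP/(_ x22)/allbP/(_ x32); rewrite c2ok.
move=> /andP[h1 h2]; split=> // w1 w2 r1 r2.
move: h1 => /allbP/(_ w1)/allbP/(_ w2)/allbP/(_ r1)/allbP/(_ r2).
by move=> /orP[-> //|] /orP[-> //|] /orP[-> //|] /orP[-> //|].
Qed.

(** The products are the weights [wA] and [wC]: what triangles of these two types lose against each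
    other in [balance_TT], they regain here against single vertices. *)
Definition triangle_single_check :=
  allb (fun u1 => allb (fun u2 => allb (fun u3 =>
  allb (fun v1 => allb (fun v2 => allb (fun v3 =>
  if ~~ labels_ok u1 u2 u3 v1 v2 v3 then true else
  let A := nA u1 v1 + (nA u2 v2 + nA u3 v3) in
  let C := nC u1 v1 + (nC u2 v2 + nC u3 v3) in
  let Z := nZ u1 v1 + (nZ u2 v2 + nZ u3 v3) in
  let O := nO u1 v1 + (nO u2 v2 + nO u3 v3) in
  (A * Z * O + C * Z * O <= 1) &&
  allb (fun x1 => allb (fun x2 => allb (fun x3 =>
  if ~~ row_ok x1 x2 x3 then true else
  allb (fun w => allb (fun r => (w && r) ||
  (uncovered u1 v1 w r x1 + (uncovered u2 v2 w r x2 + uncovered u3 v3 w r x3) + Z +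
   (A * Z * O * (nA w r + nO w r) + C * Z * O * (nC w r + nO w r))
     <= 2 + O + nO w r))))))
  )))))).

Lemma triangle_single_checkT : triangle_single_check.
Proof. by vm_cast_no_check (erefl true). Qed.

Lemma triangle_single_local u1 u2 u3 v1 v2 v3 :
  labels_ok u1 u2 u3 v1 v2 v3 ->
  let A := nA u1 v1 + (nA u2 v2 + nA u3 v3) in
  let C := nC u1 v1 + (nC u2 v2 + nC u3 v3) in
  let Z := nZ u1 v1 + (nZ u2 v2 + nZ u3 v3) in
  let O := nO u1 v1 + (nO u2 v2 + nO u3 v3) in
  A * Z * O + C * Z * O <= 1 /\
  forall x1 x2 x3 w r, row_ok x1 x2 x3 -> ~~ (w && r) ->
    uncovered u1 v1 w r x1 + (uncovered u2 v2 w r x2 + uncovered u3 v3 w r x3) + Z +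
    (A * Z * O * (nA w r + nO w r) + C * Z * O * (nC w r + nO w r))
     <= 2 + O + nO w r.
Proof.
move=> hP.
move: triangle_single_checkT => /allbP/(_ u1)/allbP/(_ u2)/allbP/(_ u3).
move=> /allbP/(_ v1)/allbP/(_ v2)/allbP/(_ v3); rewrite hP.
move=> /andP[h1 h2]; split=> // x1 x2 x3 w r xok.
move: h2 => /allbP/(_ x1)/allbP/(_ x2)/allbP/(_ x3); rewrite xok.
by move=> /allbP/(_ w)/allbP/(_ r) /orP[-> //|].
Qed.

Local Open Scope ring_scope.

(** * Ordered edges and triangles in a sequence of vertices *)

Section Counting.
Variables (V : finType) (g : rel V).
Hypotheses (gsym : symmetric g) (girr : irreflexive g).

Definition adj x y : int := (g x y)%:R.
Definition deg W x : int := \sum_(y <- W) adj x y.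
(** Twice the number of edges inside the neighbourhood of x. *)
Definition lnk W x : int := \sum_(y <- W) \sum_(z <- W) adj x y * adj x z * adj y z.
Definition arcs W : int := \sum_(x <- W) deg W x.
Definition tri W : int := \sum_(x <- W) lnk W x.
(* With t triangles, e edges and n vertices, this is 12 (t - m (e - n^2/4)):
   [tri] counts ordered triangles and [arcs] ordered edges. *)
Definition excess (W : seq V) (m : nat) : int :=
  2 * tri W + 3 * m%:R * (size W)%:R ^+ 2 - 6 * m%:R * arcs W.

Lemma adjC x y : adj x y = adj y x. Proof. by rewrite /adj gsym. Qed.
Lemma adjxx x : adj x x = 0. Proof. by rewrite /adj girr. Qed.

Lemma perm_excess W W' m : perm_eq W W' -> excess W m = excess W' m.
Proof.
move=> h; rewrite /excess /tri /arcs (perm_size h) !(perm_big _ h) /=.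
congr (_ * _ + _ - _ * _); apply: eq_bigr => x _.
  rewrite /lnk !(perm_big _ h) /=; apply: eq_bigr => y _; exact: perm_big.
exact: perm_big.
Qed.

Lemma deg_cons v W x : deg (v :: W) x = adj x v + deg W x.
Proof. by rewrite /deg big_cons. Qed.

Lemma lnk_cons v W x :
  lnk (v :: W) x = lnk W x + 2 * \sum_(y <- W) adj x v * adj x y * adj v y.
Proof.
rewrite /lnk big_cons big_cons adjxx mulr0 add0r.
under [X in _ + X]eq_bigr => y _ do rewrite big_cons.
rewrite big_split /= addrA -big_split /= addrC mulr_sumr; congr (_ + _).
by apply: eq_bigr => y _; rewrite (adjC y v); ring.
Qed.

Lemma arcs_cons u W : arcs (u :: W) = arcs W + 2 * deg W u.
Proof.
rewrite /arcs big_cons deg_cons adjxx add0r.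
under eq_bigr => x _ do rewrite deg_cons (adjC x u).
by rewrite big_split /= -/(deg W u); ring.
Qed.

Lemma tri_cons u W : tri (u :: W) = tri W + 3 * lnk W u.
Proof.
rewrite /tri big_cons lnk_cons.
under [X in 2 * X]eq_bigr => y _ do rewrite adjxx !mul0r.
rewrite big1_eq mulr0 addr0.
under eq_bigr => x _ do rewrite lnk_cons.
rewrite big_split /= -mulr_sumr.
have -> : \sum_(x <- W) \sum_(y <- W) adj x u * adj x y * adj u y = lnk W u.
  by apply: eq_bigr => x _; apply: eq_bigr => y _; rewrite (adjC x u); ring.
by ring.
Qed.

(** Removing uv also lowers the number of cliques by one. The change is arranged as sums over pairs
    of remaining vertices and over single ones, so that it can be split along any partition of
    [W]. *)
Lemma excess_cons2 u v W m : g u v ->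
  excess (u :: v :: W) m.+1 = excess W m + 3 * (
    \sum_(x <- W) \sum_(y <- W)
       (1 - 2 * (adj x y * (1 - adj u x * adj u y - adj v x * adj v y)))
    + 4 * m%:R * \sum_(x <- W) (1 - adj u x - adj v x)
    + 4 * \sum_(x <- W) (1 - adj u x) * (1 - adj v x)).
Proof.
move=> guv.
have auv : adj u v = 1 by rewrite /adj guv.
have cE : \sum_(x <- W) (1 : int) = (size W)%:R by rewrite big_tnth sumr_const card_ord.
have -> : \sum_(x <- W) (1 - adj u x - adj v x) = (size W)%:R - deg W u - deg W v.
  by rewrite !big_split /= !sumrN cE.
have -> : \sum_(x <- W) (1 - adj u x) * (1 - adj v x) =
   (size W)%:R - deg W u - deg W v + \sum_(y <- W) adj u y * adj v y.
  rewrite -cE /deg -!sumrB -big_split /=; apply: eq_bigr => x _; ring.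
have -> : \sum_(x <- W) \sum_(y <- W)
       (1 - 2 * (adj x y * (1 - adj u x * adj u y - adj v x * adj v y))) =
   (size W)%:R ^+ 2 - 2 * (arcs W - lnk W u - lnk W v).
  have -> : (size W)%:R ^+ 2 = \sum_(x <- W) \sum_(y <- W) (1 : int).
    by rewrite -cE expr2 mulr_suml; apply: eq_bigr => x _; rewrite mul1r.
  rewrite /arcs /lnk /deg -!sumrB mulr_sumr -sumrB; apply: eq_bigr => x _.
  rewrite -!sumrB mulr_sumr -sumrB; apply: eq_bigr => y _; ring.
rewrite /excess !tri_cons !arcs_cons lnk_cons deg_cons.
have -> : \sum_(y <- W) adj u v * adj u y * adj v y =
    \sum_(y <- W) adj u y * adj v y.
  by apply: eq_bigr => y _; rewrite auv mul1r.
rewrite auv /= -!natr1; ring.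
Qed.

End Counting.

Definition is_triangle (V : finType) (g : rel V) (P : seq V) :=
  if P is [:: x; y; z] then [&& g x y, g y z & g x z] else false.
Definition is_edge (V : finType) (g : rel V) (P : seq V) :=
  if P is [:: x; y] then g x y else false.
Definition triangle_free (V : finType) (g : rel V) (W : seq V) :=
  forall x y z, x \in W -> y \in W -> z \in W -> ~~ [&& g x y, g y z & g x z].
Definition independent (V : finType) (g : rel V) (W : seq V) :=
  forall x y, x \in W -> y \in W -> ~~ g x y.

(* Here a and c count the triangles and the single vertices, p and q the triangles
   labelled AZO and CZO, x and y the single vertices not labelled C, resp. A. *)
Lemma quad_types (a c p q x y : int) :
  0 <= p -> 0 <= q -> 0 <= x -> 0 <= y -> 0 <= c -> p + q <= a -> c <= x + y ->
  0 <= (a - c) ^+ 2 - 4 * (p * q) + 4 * (p * x + q * y).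
Proof.
wlog qp : p q x y / q <= p => [hw|] p0 q0 x0 y0 c0 pqa cxy.
  have [/hw|/ltW pq] := leP q p; first by apply.
  by have := hw q p y x pq q0 p0 y0 x0 c0; rewrite addrC [y + x]addrC => /(_ pqa cxy); lra.
(* The difference of the two sides is [x (p - q) + q (x + y - c)]. *)
have h1 : q * c <= p * x + q * y.
  have h2 : 0 <= x * (p - q) by apply: mulr_ge0 => //; lra.
  have h3 : 0 <= q * (x + y - c) by apply: mulr_ge0 => //; lra.
  lra.
have [hc|hc] := leP (p + q) c.
  have h2 : 0 <= q * (c - p) by apply: mulr_ge0 => //; lra.
  by have := sqr_ge0 (a - c); rewrite expr2; nra.
(* Since [0 < p + q - c <= a - c], one may replace [a - c] by [p + q - c]; then
   [(p + q - c)^2 - 4pq + 4qc] is the square of [p - q - c]. *)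
have h2 : (p + q - c) * (p + q - c) <= (a - c) * (a - c) by apply: ler_pM; lra.
have := sqr_ge0 (p - q - c); rewrite !expr2; lra.
Qed.

Lemma sum_const (R : pzSemiRingType) (I : Type) (s : seq I) (c : R) :
  \sum_(x <- s) c = (size s)%:R * c.
Proof. by rewrite big_tnth sumr_const card_ord mulr_natl. Qed.

Lemma sum_pairs (I : Type) (s : seq I) (f : I -> int) :
  \sum_(x <- s) \sum_(y <- s) (f x + f y) = 2 * (size s)%:R * \sum_(x <- s) f x.
Proof.
have h x : \sum_(y <- s) (f x + f y) = (size s)%:R * f x + \sum_(y <- s) f y.
  by rewrite big_split; congr (_ + _); exact: sum_const.
rewrite (eq_bigr _ (fun x _ => h x)) big_split.
have -> : 2 * (size s)%:R * \sum_(x <- s) f x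
   = (size s)%:R * \sum_(x <- s) f x + (size s)%:R * \sum_(x <- s) f x by ring.
by congr (_ + _); [rewrite mulr_sumr | exact: sum_const].
Qed.

Lemma sub_triangle_free (V : finType) (g : rel V) (W W' : seq V) :
  {subset W <= W'} -> triangle_free g W' -> triangle_free g W.
Proof. by move=> sub tf x y z /sub ? /sub ? /sub ?; apply: tf. Qed.

(** * The effect of deleting an edge, pair of cliques by pair of cliques *)

Section Labels.
Variables (V : finType) (g : rel V).
Hypotheses (gsym : symmetric g) (girr : irreflexive g) (hK4 : K4_free g).
Variables u v : V.

Definition label_count (f : bool -> bool -> nat) P : nat :=
  (\sum_(x <- P) f (g u x) (g v x))%N.
Definition cross P Q : nat :=
  (\sum_(x <- P) \sum_(y <- Q) uncovered (g u x) (g v x) (g u y) (g v y) (g x y))%N.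
(** The share of the ordered pair P, Q in the change of [excess], up to the factor 3. The label
    counts come from the term of [excess_cons2] with coefficient [4 * m]: m being the number of
    cliques, that term spreads evenly over pairs. *)
Definition balance P Q : int :=
  (size P)%:R * (size Q)%:R
  + 2 * ((label_count nO P)%:R + (label_count nO Q)%:R
         - (label_count nZ P)%:R - (label_count nZ Q)%:R - (cross P Q)%:R).
(* For a triangle, [wA] (resp. [wC]) is 1 if its three labels are A, Z, O
   (resp. C, Z, O), and 0 otherwise: a pair of triangles of these two types is the
   only one for which [balance] may be less than 1. *)
Definition wA P := (label_count nA P * label_count nZ P * label_count nO P)%N.
Definition wC P := (label_count nC P * label_count nZ P * label_count nO P)%N.

Lemma crossC P Q : cross P Q = cross Q P.
Proof.
rewrite /cross exchange_big /=; apply: eq_bigr => y _; apply: eq_bigr => x _.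
by rewrite /uncovered gsym [g u x && _]andbC [g v x && _]andbC.
Qed.

Lemma balanceC P Q : balance P Q = balance Q P.
Proof. by rewrite /balance crossC; ring. Qed.

(** [1 - adj u x - adj v x] is 1 on label O, -1 on Z and 0 otherwise. The inequality comes from
    adjacent x, y in both neighbourhoods, where [1 - 1 - 1] is bounded by 0, the value of
    [uncovered]. *)
Lemma excess_balance cs : g u v ->
  excess g (flatten cs) (size cs)
    + 3 * (\sum_(P <- cs) \sum_(Q <- cs) balance P Q + 4 * \sum_(P <- cs) (label_count nO P)%:R)
  <= excess g (u :: v :: flatten cs) (size cs).+1.
Proof.
move=> guv; rewrite excess_cons2 // lerD2l ler_pM2l //.
have cE : \sum_(x <- cs) (1 : int) = (size cs)%:R by rewrite big_tnth sumr_const card_ord.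
have labE f P : (label_count f P)%:R = \sum_(x <- P) (f (g u x) (g v x))%:R :> int.
  by rewrite /label_count natr_sum.
have -> : \sum_(x <- flatten cs) (1 - adj g u x - adj g v x) =
    \sum_(P <- cs) ((label_count nO P)%:R - (label_count nZ P)%:R).
  rewrite big_flatten /=; apply: eq_bigr => P _; rewrite !labE -sumrB.
  by apply: eq_bigr => x _; rewrite /adj /nO /nZ; do 2! case: g.
have -> : \sum_(x <- flatten cs) (1 - adj g u x) * (1 - adj g v x) =
    \sum_(P <- cs) (label_count nO P)%:R.
  rewrite big_flatten /=; apply: eq_bigr => P _; rewrite !labE.
  by apply: eq_bigr => x _; rewrite /adj /nO; do 2! case: g.
rewrite lerD2r.
have -> : \sum_(P <- cs) \sum_(Q <- cs) balance P Q =
  \sum_(P <- cs) \sum_(Q <- cs) ((size P)%:R * (size Q)%:R - 2 * (cross P Q)%:R)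
  + 4 * (size cs)%:R * \sum_(P <- cs) ((label_count nO P)%:R - (label_count nZ P)%:R).
  have -> : 4 * (size cs)%:R * \sum_(P <- cs) ((label_count nO P)%:R - (label_count nZ P)%:R) =
     \sum_(P <- cs) \sum_(Q <- cs) (2 * ((label_count nO P)%:R - (label_count nZ P)%:R)
        + 2 * ((label_count nO Q)%:R - (label_count nZ Q)%:R)) :> int.
    by rewrite sum_pairs -mulr_sumr; ring.
  rewrite -big_split /=; apply: eq_bigr => P _; rewrite -big_split /=.
  by apply: eq_bigr => Q _; rewrite /balance; ring.
rewrite lerD2r big_flatten /=; apply: ler_sum => P _.
under [leRHS]eq_bigr => x _ do rewrite big_flatten /=.
rewrite exchange_big /=; apply: ler_sum => Q _.
have -> : (size P)%:R * (size Q)%:R - 2 * (cross P Q)%:R =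
    \sum_(x <- P) \sum_(y <- Q)
      (1 - 2 * (uncovered (g u x) (g v x) (g u y) (g v y) (g x y))%:R) :> int.
  under eq_bigr => x _ do rewrite sumrB sum_const mulr1 -mulr_sumr -natr_sum.
  by rewrite sumrB sum_const -mulr_sumr -natr_sum.
apply: ler_sum => x _; apply: ler_sum => y _; rewrite /adj /uncovered.
by do 5! case: g.
Qed.

Lemma balance_ge (c d : nat) P Q :
  (2 * (cross P Q + (label_count nZ P + label_count nZ Q)) + c
     <= size P * size Q + 2 * (label_count nO P + label_count nO Q) + 2 * d)%N ->
  c%:R - 2 * d%:R <= balance P Q.
Proof. by rewrite /balance -(ler_nat int) !(natrD, natrM); lra. Qed.

Lemma no_K4 a b c d : ~~ [&& g a b, g a c, g a d, g b c, g b d & g c d].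
Proof.
by apply/negP => /and5P[? ? ? ? /andP[? ?]]; apply: (hK4 (a := a) (b := b) (c := c) (d := d)).
Qed.

Lemma triangle_row x1 x2 x3 y : is_triangle g [:: x1; x2; x3] ->
  row_ok (g x1 y) (g x2 y) (g x3 y).
Proof.
move=> /= /and3P[h12 h23 h13]; apply/negP => /and3P[h1 h2 h3].
by have := no_K4 x1 x2 x3 y; rewrite h12 h13 h1 h23 h2 h3.
Qed.

Lemma triangle_rows x1 x2 x3 p q : g p q -> is_triangle g [:: x1; x2; x3] ->
  rows_ok (g p x1) (g p x2) (g p x3) (g q x1) (g q x2) (g q x3).
Proof.
move=> hpq /= /and3P[h12 h23 h13]; apply/and3P; split; apply/negP => /and4P[a b c d].
- by have := no_K4 p q x1 x2; rewrite hpq a b c d h12.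
- by have := no_K4 p q x1 x3; rewrite hpq a b c d h13.
- by have := no_K4 p q x2 x3; rewrite hpq a b c d h23.
Qed.

Hypothesis guv : g u v.

Lemma triangle_labels x1 x2 x3 : is_triangle g [:: x1; x2; x3] ->
  labels_ok (g u x1) (g u x2) (g u x3) (g v x1) (g v x2) (g v x3).
Proof.
move=> hP; have := triangle_rows guv hP => /and3P[h1 h2 h3].
have := triangle_row u hP; have := triangle_row v hP.
rewrite !(gsym _ u) !(gsym _ v) /row_ok /labels_ok => -> ->.
by rewrite [g v x1 && _]andbCA [g v x1 && (g u x3 && _)]andbCA [g v x2 && _]andbCA h1 h2 h3.
Qed.

Lemma balance_TT P Q : is_triangle g P -> is_triangle g Q ->
  1 - 2 * (wA P * wC Q + wC P * wA Q)%:R <= balance P Q.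
Proof.
case: P => [|x1 [|x2 [|x3 []]]] // hP; case: Q => [|y1 [|y2 [|y3 []]]] // hQ.
apply: (balance_ge (c := 1)).
suff : (cross [:: x1; x2; x3] [:: y1; y2; y3] + label_count nZ [:: x1; x2; x3] + label_count nZ [:: y1; y2; y3]
   <= 4 + label_count nO [:: x1; x2; x3] + label_count nO [:: y1; y2; y3] +
     (wA [:: x1; x2; x3] * wC [:: y1; y2; y3] + wC [:: x1; x2; x3] * wA [:: y1; y2; y3]))%N.
  rewrite /=; lia.
have rowQ x : row_ok (g x y1) (g x y2) (g x y3).
  by rewrite !(gsym x); exact: triangle_row.
have [h12 h23 h13] := and3P hP.
rewrite /wA /wC /cross /label_count !big_cons !big_nil !addn0.
exact: (triangles_local (triangle_labels hP) (triangle_labels hQ) (rowQ x1) (rowQ x2) (rowQ x3)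
  (triangle_row y1 hP) (triangle_row y2 hP) (triangle_row y3 hP)
  (triangle_rows h12 hQ) (triangle_rows h13 hQ) (triangle_rows h23 hQ)).
Qed.

Lemma balance_TE P E : is_triangle g P -> is_edge g E ->
  triangle_free g (u :: v :: E) -> 0 <= balance P E.
Proof.
case: P => [|x1 [|x2 [|x3 []]]] // hP; case: E => [|y1 [|y2 []]] // hE tf.
apply: (balance_ge (c := 0) (d := 0)).
have h (a b c : V) : a \in [:: u; v; y1; y2] -> b \in [:: u; v; y1; y2] ->
    c \in [:: u; v; y1; y2] -> g a b -> ~~ (g a c && g b c).
  by move=> ha hb hc hab; have := tf a b c ha hb hc; rewrite hab /= andbC.
have [uU vU y1U y2U] : [/\ u \in [:: u; v; y1; y2], v \in [:: u; v; y1; y2],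
    y1 \in [:: u; v; y1; y2] & y2 \in [:: u; v; y1; y2]].
  by rewrite !inE !eqxx !orbT.
have [H _] := triangle_edge_local (triangle_labels hP) (triangle_row y1 hP) (triangle_row y2 hP).
have := H (g u y1) (g u y2) (g v y1) (g v y2).
rewrite {1}(gsym u) {1}(gsym u) {1}(gsym v) {1}(gsym v).
rewrite !h // => /(_ isT isT isT isT).
have -> : label_count nZ [:: y1; y2] = 0%N.
  rewrite /label_count !big_cons big_nil /nZ.
  by rewrite !(negbTE (h _ _ _ uU vU _ guv)).
rewrite /triangle_edge_lhs /cross /label_count !big_cons !big_nil !addn0 /=; lia.
Qed.
Lemma balance_TS P s : is_triangle g P -> ~~ (g u s && g v s) ->
  -1 + 2 * ((wA P)%:R * (label_count nA [:: s] + label_count nO [:: s])%:R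
          + (wC P)%:R * (label_count nC [:: s] + label_count nO [:: s])%:R) <= balance P [:: s].
Proof.
case: P => [|x1 [|x2 [|x3 []]]] // hP hs.
have [_ /(_ _ _ _ (g u s) (g v s) (triangle_row s hP) hs)] :=
  triangle_single_local (triangle_labels hP).
have lab1 f : label_count f [:: s] = f (g u s) (g v s) by rewrite /label_count big_seq1.
have lab3 f : label_count f [:: x1; x2; x3] =
    (f (g u x1) (g v x1) + (f (g u x2) (g v x2) + f (g u x3) (g v x3)))%N.
  by rewrite /label_count !big_cons big_nil addn0.
have Z0 : label_count nZ [:: s] = 0%N by rewrite lab1 /nZ (negbTE hs).
rewrite /balance Z0 /wA /wC /cross !lab1 !lab3 !big_cons !big_nil !addn0.
rewrite -(ler_nat int) !(natrD, natrM) /=; lra.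
Qed.

Lemma wAC_le1 P : is_triangle g P -> (wA P + wC P <= 1)%N.
Proof.
case: P => [|x1 [|x2 [|x3 []]]] // hP.
have [+ _] := triangle_single_local (triangle_labels hP).
by rewrite /wA /wC /label_count !big_cons !big_nil !addn0.
Qed.

(** The possible deficit, counted for both orders of the pair, is repaid by the term
    [4 * label_count nO P] of [excess_balance]. *)
Lemma balance_Tpair P y1 y2 : is_triangle g P ->
  g u y1 -> g v y1 -> ~~ g u y2 -> g v y2 ->
  - 2 * (label_count nO P)%:R <= balance P [:: y1; y2].
Proof.
case: P => [|x1 [|x2 [|x3 []]]] // hP u1 v1 u2 v2.
have [_ /=] := triangle_edge_local (triangle_labels hP) (triangle_row y1 hP) (triangle_row y2 hP).
rewrite /triangle_edge_lhs /balance /cross /label_count !big_cons !big_nil u1 v1 (negbTE u2) v2 !addn0.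
have -> : nZ true true = 1%N by [].
have -> : nO false true = 0%N by [].
rewrite -(ler_nat int) !natrD /=; lra.
Qed.

Lemma cross_le P Q (d : V -> nat) :
  (forall x, x \in P -> \sum_(y <- Q) g x y <= d x)%N ->
  (cross P Q <= \sum_(x <- P) d x)%N.
Proof.
move=> h; rewrite /cross !big_seq; apply: leq_sum => x xP.
apply: leq_trans (h x xP); apply: leq_sum => y _; rewrite /uncovered.
by case: (g x y) => //=; exact: leq_b1.
Qed.

Lemma label_nZ0 W : (forall x, x \in W -> ~~ (g u x && g v x)) -> label_count nZ W = 0%N.
Proof.
by move=> h; rewrite /label_count big_seq big1 // => x /h; rewrite /nZ => /negbTE ->.
Qed.

Lemma row_edge x E : is_edge g E -> triangle_free g (x :: E) -> (\sum_(y <- E) g x y <= 1)%N.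
Proof.
case: E => [|y1 [|y2 []]] //= hE tf; rewrite !big_cons big_nil addn0.
have := tf x y1 y2; rewrite !inE !eqxx !orbT => /(_ isT isT isT).
by rewrite hE; case: (g x y1); case: (g x y2).
Qed.

Definition balanceS X Y := \sum_(P <- X) \sum_(Q <- Y) balance P Q.

Lemma balanceSC X Y : balanceS X Y = balanceS Y X.
Proof.
rewrite /balanceS exchange_big /=; apply: eq_bigr => P _; apply: eq_bigr => Q _; exact: balanceC.
Qed.
Lemma balanceS_catl X Y Z : balanceS (X ++ Y) Z = balanceS X Z + balanceS Y Z.
Proof. by rewrite /balanceS big_cat. Qed.
Lemma balanceS_catr X Y Z : balanceS Z (X ++ Y) = balanceS Z X + balanceS Z Y.
Proof. by rewrite balanceSC balanceS_catl !(balanceSC _ Z). Qed.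

Lemma ler_balanceS X Y (f : seq V -> seq V -> int) :
  (forall P Q, P \in X -> Q \in Y -> f P Q <= balance P Q) ->
  \sum_(P <- X) \sum_(Q <- Y) f P Q <= balanceS X Y.
Proof.
move=> h; rewrite /balanceS big_seq [leRHS]big_seq; apply: ler_sum => P PX.
by rewrite big_seq [leRHS]big_seq; apply: ler_sum => Q QY; exact: h.
Qed.

Lemma balanceS_ge0 X Y : (forall P Q, P \in X -> Q \in Y -> 0 <= balance P Q) -> 0 <= balanceS X Y.
Proof.
move=> h; have := ler_balanceS (f := fun _ _ => 0) h.
by rewrite big1 // => P _; rewrite big1.
Qed.

Definition singles (Ss : seq V) := [seq [:: s] | s <- Ss].

(** Pairs involving an edge of [Es] contribute nonnegatively. With a triangles and c single vertices
    the rest is at least [(a - c)^2 - 4pq + 4(px + qy)], which [quad_types] handles. *)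
Lemma quad_ge0 Ts Es Ss :
  all (is_triangle g) Ts -> all (is_edge g) Es ->
  triangle_free g (u :: v :: flatten Es ++ Ss) -> independent g Ss ->
  0 <= balanceS (Ts ++ Es ++ singles Ss) (Ts ++ Es ++ singles Ss).
Proof.
move=> /allP hT /allP hE tf ind.
have uv_no x : x \in flatten Es ++ Ss -> ~~ (g u x && g v x).
  move=> hx; have := tf u v x; rewrite !inE !eqxx hx !orbT => /(_ isT isT isT).
  by rewrite guv /= andbC.
have EinU E x : E \in Es -> x \in E -> x \in flatten Es ++ Ss.
  by move=> ? ?; rewrite mem_cat; apply/orP; left; apply/flattenP; exists E.
have SinU x : x \in Ss -> x \in flatten Es ++ Ss by rewrite mem_cat => ->; rewrite orbT.
have tfE x E : E \in Es -> x \in u :: v :: flatten Es ++ Ss -> triangle_free g (x :: E).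
  move=> EE hx; apply: sub_triangle_free tf => a; rewrite inE => /orP[/eqP -> //|].
  by move=> /(EinU _ _ EE); rewrite !inE => ->; rewrite !orbT.
have TE0 : 0 <= balanceS Ts Es.
  apply: balanceS_ge0 => P E PT EE; apply: balance_TE; [exact: hT | exact: hE |].
  apply: sub_triangle_free tf => a; rewrite !inE => /or3P[-> //|->|]; first by rewrite orbT.
  by move=> /(EinU _ _ EE) ->; rewrite !orbT.
(* A vertex has at most one neighbour in an edge of [Es], so [cross] is at most half the number of
   vertex pairs; the same holds below for single vertices. *)
have EE0 : 0 <= balanceS Es Es.
  apply: balanceS_ge0 => P Q PE QE; apply: (balance_ge (c := 0) (d := 0)).
  rewrite !label_nZ0; try by move=> x xP; apply: uv_no; apply: EinU xP.
  have := cross_le (P := P) (Q := Q) (d := fun=> 1%N).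
  have := hE _ PE; have := hE _ QE; move: (PE) (QE).
  case: P {PE} => [|x1 [|x2 []]] //; case: Q {QE} => [|y1 [|y2 []]] // PE QE hQ hP.
  rewrite !big_cons big_nil => h.
  suff : (cross [:: x1; x2] [:: y1; y2] <= 1 + (1 + 0))%N by rewrite /=; lia.
  by apply: h => x hx; apply: row_edge => //; apply: tfE => //; rewrite !inE (EinU _ _ PE hx) !orbT.
have ES0 : 0 <= balanceS (singles Ss) Es.
  apply: balanceS_ge0 => P Q /mapP[s sS ->] QE; apply: (balance_ge (c := 0) (d := 0)).
  rewrite !label_nZ0; first last.
  - by move=> x; rewrite inE => /eqP ->; apply/uv_no/SinU.
  - by move=> x xP; apply: uv_no; apply: EinU xP.
  have := cross_le (P := [:: s]) (Q := Q) (d := fun=> 1%N).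
  have := hE _ QE; move: (QE).
  case: Q {QE} => [|y1 [|y2 []]] // QE hQ.
  rewrite big_seq1 => h; suff : (cross [:: s] [:: y1; y2] <= 1)%N by rewrite /=; lia.
  apply: h => x; rewrite inE => /eqP ->.
  by apply: row_edge => //; apply: tfE => //; rewrite !inE (SinU _ sS) !orbT.
have SS : (size Ss)%:R * (size Ss)%:R <= balanceS (singles Ss) (singles Ss).
  have -> : (size Ss)%:R * (size Ss)%:R =
     \sum_(P <- singles Ss) \sum_(Q <- singles Ss) 1 :> int.
    by rewrite !sum_const !size_map mulr1.
  apply: ler_balanceS => P Q /mapP[s sS ->] /mapP[r rS ->].
  have := balance_ge (c := 1) (d := 0) (P := [:: s]) (Q := [:: r]); rewrite mulr0 subr0; apply.
  rewrite !label_nZ0; try by move=> x; rewrite inE => /eqP ->; apply/uv_no/SinU.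
  have -> : cross [:: s] [:: r] = 0%N.
    by rewrite /cross !big_seq1 /uncovered (negbTE (ind _ _ sS rS)).
  by rewrite /=; lia.
pose p : int := \sum_(P <- Ts) (wA P)%:R.
pose q : int := \sum_(P <- Ts) (wC P)%:R.
(* No single vertex is labelled Z, so A or O means not C. Hence x and y together count every single
   vertex at least once. *)
pose x : int := \sum_(Q <- singles Ss) (label_count nA Q + label_count nO Q)%:R.
pose y : int := \sum_(Q <- singles Ss) (label_count nC Q + label_count nO Q)%:R.
have TT : (size Ts)%:R * (size Ts)%:R - 4 * (p * q) <= balanceS Ts Ts.
  have -> : (size Ts)%:R * (size Ts)%:R - 4 * (p * q) = \sum_(P <- Ts) \sum_(Q <- Ts)
      (1 - 2 * ((wA P)%:R * (wC Q)%:R + (wC P)%:R * (wA Q)%:R)).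
    rewrite (eq_bigr (fun P => (size Ts)%:R - 2 * ((wA P)%:R * q + (wC P)%:R * p))).
      rewrite sumrB sum_const -mulr_sumr big_split /= -!mulr_suml -/p -/q; ring.
    move=> P _; rewrite sumrB sum_const mulr1 -mulr_sumr big_split /= -!mulr_sumr -/p -/q.
    by [].
  apply: ler_balanceS => P Q PT QT; have := balance_TT (hT _ PT) (hT _ QT).
  by rewrite natrD !natrM.
have TS : - ((size Ts)%:R * (size Ss)%:R) + 2 * (p * x + q * y) <= balanceS Ts (singles Ss).
  have -> : - ((size Ts)%:R * (size Ss)%:R) + 2 * (p * x + q * y) =
    \sum_(P <- Ts) \sum_(Q <- singles Ss)
      (-1 + 2 * ((wA P)%:R * (label_count nA Q + label_count nO Q)%:R
          + (wC P)%:R * (label_count nC Q + label_count nO Q)%:R)).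
    rewrite (eq_bigr (fun P => - (size Ss)%:R + 2 * ((wA P)%:R * x + (wC P)%:R * y))).
      rewrite big_split /= sumrN sum_const -mulr_sumr big_split /= -!mulr_suml -/p -/q; ring.
    move=> P _; rewrite big_split /= sumrN sum_const mulr1 size_map -mulr_sumr.
    by rewrite big_split /= -!mulr_sumr.
  apply: ler_balanceS => P _ PT /mapP[s sS ->]; apply: balance_TS; first exact: hT.
  exact/uv_no/SinU.
have pq : p + q <= (size Ts)%:R.
  have -> : (size Ts)%:R = \sum_(P <- Ts) 1 :> int by rewrite sum_const mulr1.
  rewrite /p /q -big_split /= big_seq [leRHS]big_seq; apply: ler_sum => P PT.
  by rewrite -natrD (ler_nat int _ 1) wAC_le1 ?hT.
have xy : (size Ss)%:R <= x + y.
  have -> : (size Ss)%:R = \sum_(P <- singles Ss) 1 :> int.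
    by rewrite sum_const mulr1 size_map.
  rewrite /x /y -big_split /= big_seq [leRHS]big_seq; apply: ler_sum => P /mapP[s sS ->].
  rewrite -natrD (ler_nat int 1) /label_count !big_seq1.
  by have := uv_no s (SinU s sS); rewrite /nA /nC /nO; do 2! case: g.
have p0 : 0 <= p by apply: sumr_ge0.
have q0 : 0 <= q by apply: sumr_ge0.
have x0 : 0 <= x by apply: sumr_ge0.
have y0 : 0 <= y by apply: sumr_ge0.
have c0 : 0 <= (size Ss)%:R :> int by apply: ler0n.
rewrite !balanceS_catl !balanceS_catr (balanceSC Es Ts) (balanceSC (singles Ss) Ts) (balanceSC Es (singles Ss)).
have := quad_types p0 q0 x0 y0 c0 pq xy; lra.
Qed.

End Labels.

(* After multiplication by 12a, the defect is the square of 4E - 9a(2a + c) plus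
   nonnegative monomials. *)
Lemma base_arith (a c T E l d : int) :
  0 <= a -> 0 <= c -> 0 <= T -> 0 <= l -> 2 * (E * E) <= 3 * a * (T + 3 * a * E) ->
  c * d <= c * a ->
  0 <= 2 * (T + 3 * c * l) + 3 * (a + c) * (3 * a + c) ^+ 2 - 6 * (a + c) * (E + 2 * (c * d)).
Proof.
move=> a0 c0 T0 l0 mm cd.
have cl : 0 <= c * l by apply: mulr_ge0.
have c3 : 0 <= c * (c * c) by rewrite !mulr_ge0.
(* Multiplying by 12a is useless for a = 0, but then [mm] forces E = 0. *)
have [aE|an0] := eqVneq a 0.
  have : E * E <= 0 by move: mm; rewrite aE; lra.
  rewrite -expr2 => /(fun h => conj h (sqr_ge0 E))/andP; rewrite -eq_le sqrf_eq0 => /eqP ->.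
  have : c * (c * d) <= 0 by rewrite mulr_ge0_le0 //; move: cd; rewrite aE; lra.
  by rewrite aE expr2; lra.
have ap : 0 < a by rewrite lt_def an0.
have ac0 : 0 <= a + c by lra.
rewrite -(pmulr_rge0 _ (_ : 0 < 12 * a)); last by rewrite mulr_gt0.
have h1 : 0 <= a * (a + c) * (c * a - c * d) by rewrite !mulr_ge0 ?subr_ge0.
have h2 : 0 <= a * (c * l) by apply: mulr_ge0.
have h3 : 0 <= a * (a * (a * c)) by rewrite !mulr_ge0.
have h4 : 0 <= a * (a * (c * c)) by rewrite !mulr_ge0.
have h5 : 0 <= a * (c * (c * c)) by rewrite !mulr_ge0.
have := sqr_ge0 (4 * E - 9 * a * (2 * a + c)).
rewrite !expr2; lra.
Qed.

(** Lagrange's identity, from which Cauchy-Schwarz for the degrees follows. *)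
Lemma sum_sqr_diff (R : comNzRingType) (I : Type) (s : seq I) (f : I -> R) :
  \sum_(x <- s) \sum_(y <- s) (f x - f y) ^+ 2 =
  2 * (size s)%:R * (\sum_(x <- s) f x ^+ 2) - 2 * (\sum_(x <- s) f x) ^+ 2.
Proof.
have h x : \sum_(y <- s) (f x - f y) ^+ 2 =
    (size s)%:R * f x ^+ 2 - 2 * f x * (\sum_(y <- s) f y) + \sum_(y <- s) f y ^+ 2.
  rewrite -sum_const mulr_sumr -sumrB -big_split /=; apply: eq_bigr => y _; ring.
rewrite (eq_bigr _ (fun x _ => h x)) big_split sumrB /= sum_const -!mulr_sumr -mulr_suml -mulr_sumr.
ring.
Qed.

(** For an adjacency matrix the left side counts ordered edges together with a vertex adjacent to
    neither end; expanding the product gives the right side. *)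
Lemma sum_codegree_complement (R : comNzRingType) (I : Type) (s : seq I) (a : I -> I -> R) :
  (forall x y, a x y = a y x) ->
  \sum_(x <- s) \sum_(y <- s) a x y * (\sum_(z <- s) (1 - a x z) * (1 - a y z)) =
  (size s)%:R * (\sum_(x <- s) \sum_(y <- s) a x y)
  - 2 * (\sum_(x <- s) (\sum_(y <- s) a x y) ^+ 2)
  + \sum_(x <- s) \sum_(y <- s) \sum_(z <- s) a x y * a x z * a y z.
Proof.
move=> aC; pose d x := \sum_(y <- s) a x y.
have -> : 2 * (\sum_(x <- s) (\sum_(y <- s) a x y) ^+ 2) =
    \sum_(x <- s) \sum_(y <- s) a x y * d x + \sum_(x <- s) \sum_(y <- s) a x y * d y.
  rewrite [X in _ + X]exchange_big /= -big_split mulr_sumr; apply: eq_bigr => x _ /=.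
  rewrite -!mulr_suml -/(d x) (eq_bigr (fun y => a x y)) => [|y _]; last exact: aC.
  by rewrite -/(d x); ring.
rewrite mulr_sumr opprD addrA -!sumrB -big_split; apply: eq_bigr => x _ /=.
rewrite mulr_sumr -!sumrB -big_split; apply: eq_bigr => y _ /=.
have -> : \sum_(z <- s) (1 - a x z) * (1 - a y z) =
    (size s)%:R - d x - d y + \sum_(z <- s) a x z * a y z.
  rewrite -[(size s)%:R]mulr1 -sum_const /d -!sumrB -big_split; apply: eq_bigr => z _ /=; ring.
have -> : \sum_(z <- s) a x y * a x z * a y z = a x y * \sum_(z <- s) a x z * a y z.
  by rewrite mulr_sumr; apply: eq_bigr => z _; rewrite mulrA.
ring.
Qed.

(** * The Moon-Moser bound and the deletion steps *)

Section Excess.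
Variables (V : finType) (g : rel V).
Hypotheses (gsym : symmetric g) (girr : irreflexive g) (hK4 : K4_free g).

Lemma adj_ge0 x y : 0 <= adj g x y. Proof. exact: ler0n. Qed.

Lemma lnk_ge0 W x : 0 <= lnk g W x.
Proof. by apply: sumr_ge0 => y _; apply: sumr_ge0 => z _; rewrite !mulr_ge0 ?adj_ge0. Qed.

Lemma tri_ge0 W : 0 <= tri g W.
Proof. by apply: sumr_ge0 => x _; exact: lnk_ge0. Qed.

Lemma sqr_arcs_le W : arcs g W ^+ 2 <= (size W)%:R * \sum_(x <- W) deg g W x ^+ 2.
Proof.
have : 0 <= \sum_(x <- W) \sum_(y <- W) (deg g W x - deg g W y) ^+ 2.
  by apply: sumr_ge0 => x _; apply: sumr_ge0 => y _; exact: sqr_ge0.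
rewrite sum_sqr_diff /arcs; lra.
Qed.

(** In unordered counts this is [t >= e (4e - n^2) / (3n)]. It combines the nonnegativity of the
    count in [sum_codegree_complement] with Cauchy-Schwarz. *)
Lemma moon_moser W :
  2 * (arcs g W * arcs g W) <= (size W)%:R * (tri g W + (size W)%:R * arcs g W).
Proof.
have : 0 <= \sum_(x <- W) \sum_(y <- W) adj g x y *
   \sum_(z <- W) (1 - adj g x z) * (1 - adj g y z).
  apply: sumr_ge0 => x _; apply: sumr_ge0 => y _; rewrite mulr_ge0 ?adj_ge0 //.
  apply: sumr_ge0 => z _; rewrite /adj; by case: (g x z); case: (g y z).
rewrite sum_codegree_complement; last exact: adjC.
move=> h; have := sqr_arcs_le W; rewrite expr2 /arcs /deg => h2.
have := mulr_ge0 (ler0n int (size W)) h.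
rewrite /tri /lnk; move: (\sum_(x <- W) _ ^+ 2) h2 => D.
move: (\sum_(x <- W) _) (\sum_(x <- W) _) (size W)%:R => A B c; lra.
Qed.

Lemma independent_cons s Ss : independent g (s :: Ss) ->
  independent g Ss /\ forall t, t \in Ss -> adj g s t = 0.
Proof.
move=> ind; split=> [x y hx hy|t ht].
  by apply: ind; rewrite inE ?hx ?hy orbT.
by rewrite /adj (negbTE (ind s t _ _)) // inE ?eqxx ?ht ?orbT.
Qed.

Lemma counts_independent Ss W : independent g Ss ->
  arcs g (Ss ++ W) = arcs g W + 2 * \sum_(s <- Ss) deg g W s /\
  tri g (Ss ++ W) = tri g W + 3 * \sum_(s <- Ss) lnk g W s.
Proof.
elim: Ss => [|s Ss IH] => [_|/independent_cons[/IH [IHa IHt] s0]].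
  by rewrite !big_nil !mulr0 !addr0.
rewrite cat_cons arcs_cons // tri_cons // IHa IHt !big_cons.
have -> : deg g (Ss ++ W) s = deg g W s.
  by rewrite /deg big_cat /= big_seq big1 ?add0r // => t /s0.
have -> : lnk g (Ss ++ W) s = lnk g W s.
  rewrite /lnk big_cat /= big_seq big1 ?add0r => [|t /s0 ->]; last first.
    by rewrite big1 // => z _; rewrite !mul0r.
  apply: eq_bigr => y _; rewrite big_cat /= big_seq big1 ?add0r // => t /s0 ->.
  by rewrite mulr0 mul0r.
by split; ring.
Qed.

(** An edge or triangle meets an independent [Ss] at most once, so each vertex of [Ss] contributes
    separately: for fixed sizes the excess is affine in the multiset [Ss]. *)
Lemma excess_independent W Ss m : independent g Ss ->
  excess g (W ++ Ss) m = 2 * tri g W + 3 * m%:R * (size W + size Ss)%:R ^+ 2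
    - 6 * m%:R * arcs g W
    + \sum_(s <- Ss) (6 * lnk g W s - 12 * m%:R * deg g W s).
Proof.
move=> ind; rewrite (perm_excess g m (permEl (perm_catC W Ss))) /excess.
have [-> ->] := counts_independent W ind.
rewrite size_cat addnC sumrB -!mulr_sumr; ring.
Qed.

Lemma independent_nseq c s : independent g (nseq c s).
Proof. by move=> x y /nseqP[-> _] /nseqP[-> _]; rewrite girr. Qed.

Lemma triangle_free3 a b c : ~~ [&& g a b, g b c & g a c] -> triangle_free g [:: a; b; c].
Proof.
move=> h x y z; rewrite !inE => hx hy hz; apply/negP => /and3P[xy yz xz].
case/negP: h; move: hx hy hz xy yz xz.
do 3! case/or3P=> /eqP ->; rewrite ?girr //.
all: by rewrite ?(gsym b a) ?(gsym c a) ?(gsym c b) => h1 h2 h3; rewrite ?h1 ?h2 ?h3.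
Qed.

(** Deletes an edge of the matching in [excess_ge0], and what is left of a broken triangle in
    [excess_twins]. *)
Lemma pair_step u v Ts Es Ss : g u v ->
  all (is_triangle g) Ts -> all (is_edge g) Es ->
  triangle_free g (u :: v :: flatten Es ++ Ss) -> independent g Ss ->
  excess g (flatten Ts ++ flatten Es ++ Ss) (size Ts + size Es + size Ss) <=
  excess g (u :: v :: flatten Ts ++ flatten Es ++ Ss) (size Ts + size Es + size Ss).+1.
Proof.
move=> guv hT hE tf ind.
set W := flatten Ts ++ _; set m := (_ + size Ss)%N.
have flatW : flatten (Ts ++ Es ++ singles Ss) = W.
  by rewrite !flatten_cat /singles flatten_map1 map_id.
have sizem : size (Ts ++ Es ++ singles Ss) = m by rewrite !size_cat size_map addnA.
rewrite -flatW -sizem; refine (le_trans _ (excess_balance gsym girr _ guv)).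
rewrite lerDl; apply: mulr_ge0 => //; apply: addr_ge0.
  exact: (quad_ge0 gsym hK4 guv hT hE tf ind).
by apply: mulr_ge0 => //; apply: sumr_ge0 => P _; exact: ler0n.
Qed.

(** Here u is a copy of s and v, x2, x3 a triangle with u adjacent to v and x2. As u, v, x2 is a
    triangle too, [pair_step] does not apply. But x2 and x3 lie in N(v), as do all copies of u, so
    the pair x2x3 has zero [cross] with itself and with them; only its balance with [Ts] can be
    negative. *)
Lemma twin_step u v x2 x3 Ts c (Ss := nseq c u) : g u v -> g x2 x3 ->
  g u x2 -> g v x2 -> ~~ g u x3 -> g v x3 -> all (is_triangle g) Ts ->
  excess g [:: x2, x3 & flatten Ts ++ Ss] (size Ts + size Ss).+1 <=
  excess g [:: u, v, x2, x3 & flatten Ts ++ Ss] (size Ts + size Ss).+2.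
Proof.
move=> guv g23 u2 v2 u3 v3 hT.
have hS s : s \in Ss -> ~~ g u s && g v s.
  by move=> /nseqP[-> _]; rewrite girr gsym guv.
have ind : independent g Ss by exact: independent_nseq.
set W := x2 :: _; set m := (_ + size Ss).+1.
pose E := [:: x2; x3]; pose R := Ts ++ singles Ss.
have flatW : flatten (E :: R) = W.
  by rewrite /= flatten_cat /singles flatten_map1 map_id.
have sizem : size (E :: R) = m by rewrite /= size_cat size_map.
rewrite -flatW -sizem; refine (le_trans _ (excess_balance gsym girr _ guv)).
rewrite lerDl; apply: mulr_ge0 => //.
have tf : triangle_free g (u :: v :: flatten [::] ++ Ss).
  apply: sub_triangle_free (triangle_free3 (a := u) (b := v) (c := u) _); last first.
    by rewrite girr !andbF.
  by move=> x; rewrite !inE mem_nseq => /or3P[->|->|/andP[_ ->]]; rewrite ?orbT.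
have RR := quad_ge0 gsym hK4 guv hT (isT : all (is_edge g) [::]) tf ind.
have cross0 Q : (forall y, y \in Q -> g v y) -> cross g u v E Q = 0%N.
  move=> hQ; rewrite /cross big_seq big1 // => x xE; rewrite big_seq big1 // => y /hQ vy.
  have -> : g v x by move: xE; rewrite !inE => /orP[]/eqP ->.
  by rewrite /uncovered vy !andbF.
have labE : label_count g u v nO E = 0%N /\ label_count g u v nZ E = 1%N.
  by rewrite /label_count !big_cons !big_nil u2 v2 (negbTE u3) v3.
have EE : 0 <= balance g u v E E.
  rewrite /balance cross0; last by move=> y; rewrite !inE => /orP[]/eqP ->.
  by case: labE => -> ->.
have ES Q : Q \in singles Ss -> 0 <= balance g u v E Q.
  case/mapP=> s /hS /andP[us vs] ->; rewrite /balance cross0; last first.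
    by move=> y; rewrite inE => /eqP ->.
  by case: labE => -> ->; rewrite /label_count !big_seq1 (negbTE us) vs.
have ET Q : Q \in Ts -> - 2 * (label_count g u v nO Q)%:R <= balance g u v E Q.
  by move=> QT; rewrite balanceC // balance_Tpair // (allP hT).
have ER : - 2 * \sum_(Q <- R) (label_count g u v nO Q)%:R <= \sum_(Q <- R) balance g u v E Q.
  rewrite mulr_sumr big_seq [leRHS]big_seq; apply: ler_sum => Q.
  rewrite mem_cat => /orP[/ET //|/ES]; apply: le_trans.
  by rewrite mulNr oppr_le0 mulr_ge0 // ler0n.
have RE : \sum_(P <- R) balance g u v P E = \sum_(Q <- R) balance g u v E Q.
  by apply: eq_bigr => P _; rewrite balanceC.
have -> : \sum_(P <- E :: R) \sum_(Q <- E :: R) balance g u v P Q =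
   balance g u v E E + 2 * \sum_(Q <- R) balance g u v E Q + balanceS g u v R R.
  have RER : \sum_(P <- R) \sum_(Q <- E :: R) balance g u v P Q =
      \sum_(Q <- R) balance g u v E Q + balanceS g u v R R.
    by rewrite -RE /balanceS -big_split; apply: eq_bigr => P _; rewrite big_cons.
  rewrite big_cons RER big_cons.
  by move: (\sum_(Q <- R) _) (balanceS _ _ _ _ _) (balance _ _ _ _ _) => ? ? ?; lra.
rewrite big_cons (proj1 labE) add0r.
move: RR ER EE; rewrite cat0s -/R.
move: (balanceS _ _ _ _ _) (balance _ _ _ _ _) (\sum_(Q <- R) _) (\sum_(Q <- R) _) => ? ? ? ?; lra.
Qed.

(** Each triangle contains at most one neighbour of s, so the degree of s is at most [size Ts]; with
    [moon_moser] this feeds [base_arith]. *)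
Lemma excess_base Ts c s : all (is_triangle g) Ts ->
  (0 < c -> forall T, T \in Ts -> count (g s) T <= 1)%N ->
  0 <= excess g (flatten Ts ++ nseq c s) (size Ts + c).
Proof.
move=> hT hs; rewrite excess_independent; last exact: independent_nseq.
have size3 : size (flatten Ts) = (3 * size Ts)%N.
  elim: Ts hT {hs} => [|T Ts IH] //= /andP[hT /IH]; rewrite size_cat => ->.
  by case: T hT => [|? [|? [|? []]]] //= _; lia.
have degs : c%:R * deg g (flatten Ts) s <= c%:R * (size Ts)%:R.
  case: c hs => [|c] hs; first by rewrite !mul0r.
  rewrite ler_pM2l ?ltr0n // /deg big_flatten /=.
  have -> : (size Ts)%:R = \sum_(T <- Ts) 1 :> int by rewrite sum_const mulr1.
  rewrite big_seq [leRHS]big_seq; apply: ler_sum => T /(hs isT).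
  by rewrite -(ler_nat int) -sum1_count natr_sum big_mkcond /=; apply: le_trans;
     apply: ler_sum => x _; rewrite /adj; case: g.
have := base_arith (a := (size Ts)%:R) (c := c%:R) (T := tri g (flatten Ts))
   (E := arcs g (flatten Ts)) (l := lnk g (flatten Ts) s) (d := deg g (flatten Ts) s).
rewrite !ler0n tri_ge0 lnk_ge0 => /(_ isT isT isT isT).
have := moon_moser (flatten Ts); rewrite size3 size_nseq natrM => mm /(_ mm degs).
by rewrite big_nseq iter_addr_0 !(natrD, natrM) -[_ *+ c]mulr_natl; lra.
Qed.
End Excess.

Lemma sum_affine (R : comNzRingType) (I : Type) (s : seq I) (k c : R) (f : I -> R) :
  \sum_(x <- s) (k + c * f x) = (size s)%:R * k + c * \sum_(x <- s) f x.
Proof. by rewrite big_split /= sum_const -mulr_sumr. Qed.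

(** * Nonnegativity of the excess for triangles, edges and single vertices *)

Section Key.
Variables (V : finType) (g : rel V).
Hypotheses (gsym : symmetric g) (girr : irreflexive g) (hK4 : K4_free g).

Lemma triangle_reorder T s : is_triangle g T -> (1 < count (g s) T)%N ->
  exists x1 x2 x3, [/\ perm_eq T [:: x1; x2; x3], is_triangle g [:: x1; x2; x3],
    g s x1, g s x2 & ~~ g s x3].
Proof.
case: T => [|a [|b [|c []]]] // hT; have := triangle_row hK4 s hT.
have /and3P[ab bc ac] := hT.
rewrite /row_ok !(gsym _ s) /= addn0.
case sa: (g s a); case sb: (g s b); case sc: (g s c) => // _ _.
- by exists a, b, c; rewrite sa sb sc perm_refl.
- exists a, c, b; rewrite sa sb sc /= ab ac (gsym c) bc; split=> //.
  by apply/permP => p /=; ring.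
- exists b, c, a; rewrite sa sb sc /= bc (gsym c) ac (gsym b) ab; split=> //.
  by apply/permP => p /=; ring.
Qed.

(** Induction on the number of triangles: if s has two neighbours in one of them, two deletions
    remove that triangle and one copy of s, and [m] drops by 2. *)
Lemma excess_twins Ts c s : all (is_triangle g) Ts ->
  0 <= excess g (flatten Ts ++ nseq c s) (size Ts + c).
Proof.
have [n] := ubnP (size Ts); elim: n => // n IH in Ts c *; rewrite ltnS => szT hT.
have [/andP[c0 /hasP[T TT sT]]|] := boolP ((0 < c)%N && has (fun T => 1 < count (g s) T)%N Ts);
  last first.
  move=> h; apply: excess_base => // c0 T TT; rewrite leqNgt; apply: contra h => h.
  by rewrite c0; apply/hasP; exists T.
case: c c0 => // c _.
have [x1 [x2 [x3 [hperm htri s1 s2 s3]]]] := triangle_reorder (allP hT _ TT) sT.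
have /and3P[h12 h23 h13] := htri.
pose Ts' := rem T Ts.
have hT' : all (is_triangle g) Ts' by apply/allP => U /mem_rem /(allP hT).
have szTs : size Ts = (size Ts').+1 by rewrite size_rem //; case: (Ts) TT.
have pT : perm_eq (flatten Ts) (T ++ flatten Ts').
  by apply: (perm_flatten (perm_to_rem TT)).
have pW : perm_eq (flatten Ts ++ nseq c.+1 s)
    [:: s, x1, x2, x3 & flatten Ts' ++ nseq c s].
  apply/permP => p; rewrite count_cat (permP pT) count_cat (permP hperm) /= count_cat; ring.
rewrite (perm_excess _ _ pW) szTs addSn addnS.
have := twin_step gsym girr hK4 c s1 h23 s2 h12 s3 h13 hT'.
rewrite size_nseq; apply: le_trans.
have p23 : perm_eq [:: x2, x3 & flatten Ts' ++ nseq c s] [:: x3, x2 & flatten Ts' ++ nseq c s].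
  by apply/permP => p /=; ring.
rewrite (perm_excess _ _ p23).
have g32 : g x3 x2 by rewrite gsym.
(* After s and x1 are gone, x2x3 is removed by [pair_step], since x3 is not adjacent to s. *)
have tf : triangle_free g (x3 :: x2 :: flatten [::] ++ nseq c s).
  apply: sub_triangle_free (triangle_free3 gsym girr (a := x3) (b := x2) (c := s) _).
    by move=> x; rewrite !inE mem_nseq => /or3P[->|->|/andP[_ ->]]; rewrite ?orbT.
  by rewrite (gsym x3 s) (negbTE s3) !andbF.
have := pair_step gsym girr hK4 g32 hT' (isT : all (is_edge g) [::]) tf
  (independent_nseq girr (c := c) (s := s)).
rewrite /= addn0 size_nseq; apply: le_trans.
by apply: IH => //; rewrite -szTs.
Qed.

(* The excess is affine in the multiset of single vertices, so it is an average of
   excesses in which all of them are copies of the same vertex. *)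
Lemma excess_singles Ts Ss : all (is_triangle g) Ts -> independent g Ss ->
  0 <= excess g (flatten Ts ++ Ss) (size Ts + size Ss).
Proof.
move=> hT ind; have [Ss0|] := posnP (size Ss).
  (* There is nothing to average over; any vertex serves as s, taken with 0 copies. *)
  rewrite (size0nil Ss0) /= addn0 cats0.
  case: Ts hT => [_|T Ts hT].
    by rewrite /excess /tri /arcs !big_nil /= !(mulr0n, mulr0, mul0r, addr0, subr0).
  have /= := hT; case: T hT => [|x T hT _] //.
  by have := excess_twins 0 x hT; rewrite cats0 addn0.
set c := size Ss => c0.
have h s : 0 <= excess g (flatten Ts ++ nseq c s) (size Ts + c) by exact: excess_twins.
pose K := 2 * tri g (flatten Ts)
   + 3 * (size Ts + c)%:R * (size (flatten Ts) + c)%:R ^+ 2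
   - 6 * (size Ts + c)%:R * arcs g (flatten Ts).
pose f s := 6 * lnk g (flatten Ts) s - 12 * (size Ts + c)%:R * deg g (flatten Ts) s.
(* [K + c f(s)] is the excess with c copies of s; its average over [Ss] is the excess sought. *)
have hK s : 0 <= K + c%:R * f s.
  move: (h s); rewrite excess_independent //; last exact: independent_nseq.
  by rewrite size_nseq big_nseq iter_addr_0 -[_ *+ c]mulr_natl.
rewrite excess_independent // -/c -/K -(pmulr_rge0 _ (_ : 0 < c%:R)) ?ltr0n //.
have -> : c%:R * (K + \sum_(s <- Ss) f s) = \sum_(s <- Ss) (K + c%:R * f s).
  by rewrite sum_affine mulrDr.
by apply: sumr_ge0 => s _; exact: hK.
Qed.

Lemma excess_ge0 Ts Es Ss :
  all (is_triangle g) Ts -> all (is_edge g) Es ->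
  triangle_free g (flatten Es ++ Ss) -> independent g Ss ->
  0 <= excess g (flatten Ts ++ flatten Es ++ Ss) (size Ts + size Es + size Ss).
Proof.
move=> hT hE tf ind; elim: Es hE tf => [|E Es IH] /=.
  by move=> _ _; rewrite addn0; exact: excess_singles.
case: E => [|x [|y []]] //= /andP[hxy hE] tf.
have hp : perm_eq (flatten Ts ++ [:: x, y & flatten Es] ++ Ss)
    [:: x, y & flatten Ts ++ flatten Es ++ Ss].
  by apply/permP => p; rewrite /= !count_cat /= count_cat; ring.
rewrite (perm_excess _ _ hp) addnS addSn.
apply: le_trans (pair_step gsym girr hK4 hxy hT hE tf ind); apply: IH => //.
by apply: sub_triangle_free tf => z; rewrite !inE => ->; rewrite !orbT.
Qed.
End Key.

(** * Greedy partition into triangles, edges and an independent set *)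

Section Partition.
Variables (V : finType) (g : rel V).
Hypotheses (gsym : symmetric g) (girr : irreflexive g).

Lemma triangle_partition (U : seq V) : uniq U -> exists Ts W,
  [/\ perm_eq U (flatten Ts ++ W), all (is_triangle g) Ts & triangle_free g W].
Proof.
have [n] := ubnP (size U); elim: n => // n IH in U *; rewrite ltnS => szU uU.
pose P (t : V * V * V) := [&& t.1.1 \in U, t.1.2 \in U, t.2 \in U &
   is_triangle g [:: t.1.1; t.1.2; t.2]].
have [/existsP[[[x y] z] /and4P[/= xU yU zU hT]]|hno] := boolP [exists t, P t]; last first.
  exists [::], U; split=> // x y z xU yU zU; apply: contra hno => h.
  by apply/existsP; exists (x, y, z); rewrite /P /= xU yU zU.
have /and3P[xy yz xz] := hT.
have neq a b : g a b -> b != a by move=> h; apply/eqP => e; move: h; rewrite e girr.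
pose U' := rem z (rem y (rem x U)).
have p1 : perm_eq U (x :: rem x U) by exact: perm_to_rem.
have p2 : perm_eq (rem x U) (y :: rem y (rem x U)).
  by apply: perm_to_rem; rewrite mem_rem_uniq // inE yU neq.
have p3 : perm_eq (rem y (rem x U)) (z :: U').
  by apply: perm_to_rem; rewrite mem_rem_uniq ?rem_uniq // inE mem_rem_uniq // inE zU !neq.
have pU : perm_eq U [:: x, y, z & U'].
  apply/permP => p; move/permP: p1 => /(_ p) ->; move/permP: p2 => /(_ p) /= ->.
  by move/permP: p3 => /(_ p) /= ->.
have szU' : (size U' < n)%N by move: (perm_size pU) szU => /= -> /ltnW/ltnW.
have uU' : uniq U' by rewrite !rem_uniq.
have [Ts [W [hp hTs tf]]] := IH U' szU' uU'.
exists ([:: x; y; z] :: Ts), W; split=> //=; last by move: hT => /= ->.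
by apply: perm_trans pU _; rewrite /= !perm_cons.
Qed.

Lemma edge_partition (U : seq V) : uniq U -> exists Es Ss,
  [/\ perm_eq U (flatten Es ++ Ss), all (is_edge g) Es & independent g Ss].
Proof.
have [n] := ubnP (size U); elim: n => // n IH in U *; rewrite ltnS => szU uU.
pose P (t : V * V) := [&& t.1 \in U, t.2 \in U & g t.1 t.2].
have [/existsP[[x y] /and3P[/= xU yU xy]]|hno] := boolP [exists t, P t]; last first.
  exists [::], U; split=> // x y xU yU; apply: contra hno => h.
  by apply/existsP; exists (x, y); rewrite /P /= xU yU.
have neq : y != x by apply/eqP => e; move: xy; rewrite e girr.
pose U' := rem y (rem x U).
have p1 : perm_eq U (x :: rem x U) by exact: perm_to_rem.
have p2 : perm_eq (rem x U) (y :: U').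
  by apply: perm_to_rem; rewrite mem_rem_uniq // inE yU neq.
have pU : perm_eq U [:: x, y & U'].
  by apply/permP => p; move/permP: p1 => /(_ p) ->; move/permP: p2 => /(_ p) /= ->.
have szU' : (size U' < n)%N by move: (perm_size pU) szU => /= -> /ltnW.
have uU' : uniq U' by rewrite !rem_uniq.
have [Es [Ss [hp hEs ind]]] := IH U' szU' uU'.
exists ([:: x; y] :: Es), Ss; split=> //=; last by rewrite xy.
by apply: perm_trans pU _; rewrite /= !perm_cons.
Qed.
End Partition.

Lemma packing_arith (m n e f t T A : int) :
  0 <= 2 * T + 3 * m * n ^+ 2 - 6 * m * A -> m * (2 * e) <= m * A ->
  T <= 6 * t -> t <= m * f -> m * (4 * e) <= m * (4 * f + n ^+ 2).
Proof. by move=> *; lra. Qed.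

(** * Edge and triangle counts, and the colouring of triangles *)

Section Packing.
Variables (V : finType) (g : rel V).
Hypotheses (gsym : symmetric g) (girr : irreflexive g) (hK4 : K4_free g).

Lemma adj_neq x y : g x y -> x != y.
Proof. by move=> h; apply/eqP => e; move: h; rewrite e girr. Qed.

Lemma arcs_ge : 2 * (#|edges g|)%:R <= arcs g (enum V).
Proof.
have -> : arcs g (enum V) = (\sum_(p : V * V | g p.1 p.2) 1)%N%:R.
  rewrite /arcs /deg big_enum [in RHS]big_mkcond -(pair_bigA _ (fun x y => if g x y then 1 else 0)%N).
  rewrite natr_sum; apply: eq_big => // x _; rewrite big_enum natr_sum.
  by apply: eq_big => // y _; rewrite /adj; case: g.
rewrite -natrM ler_nat (partition_big (fun p => [set p.1; p.2]) (mem (edges g))) /=; last first.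
  by move=> [x y] /= h; rewrite inE; apply/existsP; exists x; apply/existsP; exists y; rewrite h /=.
rewrite mulnC -sum_nat_const; apply: leq_sum => E.
rewrite inE => /existsP[x /existsP[y /andP[h /eqP ->]]].
(* The fibre over an edge contains its two orientations. *)
rewrite sum1dep_card; have xy := adj_neq h.
apply: (@leq_trans #|[set (x, y); (y, x)]|).
  by rewrite cards2 xpair_eqE (negbTE xy).
apply: subset_leq_card; apply/subsetP => p; rewrite !inE => /orP[]/eqP -> /=.
  by rewrite h eqxx.
by rewrite gsym h setUC eqxx.
Qed.

Lemma tri_le : tri g (enum V) <= 6 * (#|triangles g|)%:R.
Proof.
pose b (t : V * V * V) := [&& g t.1.1 t.1.2, g t.1.2 t.2 & g t.1.1 t.2].
have -> : tri g (enum V) = (\sum_(t | b t) 1)%N%:R.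
  pose c x y z := (if [&& g x y, g y z & g x z] then 1 else 0)%N.
  rewrite [in RHS]big_mkcond -(pair_bigA _ (fun p => c p.1 p.2)).
  rewrite -(pair_bigA _ (fun x y => \sum_z c x y z)%N).
  rewrite /tri /lnk big_enum natr_sum; apply: eq_big => // x _.
  rewrite big_enum natr_sum; apply: eq_big => // y _.
  rewrite big_enum natr_sum; apply: eq_big => // z _.
  by rewrite /adj /c /=; case: (g x y); case: (g x z); case: (g y z).
rewrite -natrM ler_nat (partition_big (fun t => [set t.1.1; t.1.2; t.2]) (mem (triangles g))) /=;
  last first.
  move=> [[x y] z] /and3P[/= xy yz xz]; rewrite inE.
  apply/existsP; exists x; apply/existsP; exists y; apply/existsP; exists z.
  by rewrite xy yz xz /=.
rewrite mulnC -sum_nat_const; apply: leq_sum => T.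
rewrite inE => /existsP[p /existsP[q /existsP[r /and4P[pq qr pr /eqP ->]]]].
rewrite sum1dep_card.
(* The fibre over a triangle lies among its six orderings. *)
apply: (@leq_trans (size [:: (p, q, r); (p, r, q); (q, p, r); (q, r, p); (r, p, q); (r, q, p)])) => //.
apply: leq_trans (card_size _); apply: subset_leq_card; apply/subsetP => -[[x y] z].
rewrite !inE => /andP[/and3P[/= xy yz xz] /eqP/setP eT].
have := eT x; have := eT y; have := eT z; rewrite !inE !eqxx !orbT => hz hy hx.
move: (adj_neq xy) (adj_neq yz) (adj_neq xz); rewrite !xpair_eqE {eT xy yz xz}.
move: hx hy hz; do 3! move=> /esym/orP[/orP[]|] /eqP ->.
all: by rewrite ?eqxx ?orbT ?andbT.
Qed.

Lemma triangle_third T u v : T \in triangles g -> u \in T -> v \in T -> u != v ->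
  exists w, [/\ T = [set u; v; w], g u v, g u w & g v w].
Proof.
rewrite inE => /existsP[p /existsP[q /existsP[r /and4P[pq qr pr /eqP ->]]]].
have [qp rq rp] : [/\ g q p, g r q & g r p] by rewrite !(gsym q p, gsym r q, gsym r p).
rewrite !inE => /orP[/orP[]|] /eqP -> /orP[/orP[]|] /eqP ->; rewrite ?eqxx // => _.
- by exists r.
- by exists q; split=> //; apply/setP => x; rewrite !inE orbAC.
- by exists r; split=> //; apply/setP => x; rewrite !inE [(x == q) || _]orbC.
- by exists p; split=> //; apply/setP => x; rewrite !inE; do 3! case: eqP.
- by exists q; split=> //; apply/setP => x; rewrite !inE; do 3! case: eqP.
- by exists p; split=> //; apply/setP => x; rewrite !inE; do 3! case: eqP.
Qed.

Lemma large_packing (cs : seq (seq V)) : (0 < size cs)%N ->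
  (forall x, x \in flatten cs) ->
  {in cs, forall P : seq V, {in P &, forall x y, x != y -> g x y}} ->
  exists F, edge_disjoint_triangles g F /\ (#|triangles g| <= size cs * #|F|)%N.
Proof.
move=> m0 cover clq.
pose idx x := find (fun P : seq V => x \in P) cs.
have has_idx x : has (fun P : seq V => x \in P) cs.
  by have /flattenP[P PC xP] := cover x; apply/hasP; exists P.
have idx_lt x : (idx x < size cs)%N by rewrite -has_find.
have idx_adj x y : idx x = idx y -> x != y -> g x y.
  move=> e xy; apply: (clq (nth [::] cs (idx x))) => //; first by rewrite mem_nth.
    exact: (nth_find [::] (has_idx x)).
  by rewrite e; exact: (nth_find [::] (has_idx y)).
pose col (T : {set V}) : 'I_(size cs) := Ordinal (ltn_pmod (\sum_(x in T) idx x) m0).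
pose F i := [set T in triangles g | col T == i].
pose i0 : 'I_(size cs) := Ordinal m0.
(* Pigeonhole: the largest of the [size cs] colour classes is the packing. *)
pose i := [arg max_(j > i0) #|F j|].
have iP j : (#|F j| <= #|F i|)%N by rewrite /i; case: arg_maxnP => // k _ /(_ j isT).
exists (F i); split; last first.
  rewrite -sum1_card (partition_big col xpredT) //=.
  rewrite -[X in (_ <= X * _)%N]card_ord -sum_nat_const; apply: leq_sum => j _.
  by apply: leq_trans (iP j); rewrite sum1dep_card cardsE.
split; first by apply/subsetP => T; rewrite inE => /andP[].
move=> T1 T2 /setIdP[t1 /eqP c1] /setIdP[t2 /eqP c2] neq.
rewrite leqNgt; apply/negP => /card_gt1P[u [v [uI vI uv]]].
move: uI vI; rewrite !inE => /andP[u1 u2] /andP[v1 v2].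
have [w1 [e1 guv gu1 gv1]] := triangle_third (T := T1) (u := u) (v := v) t1 u1 v1 uv.
have [w2 [e2 _ gu2 gv2]] := triangle_third (T := T2) (u := u) (v := v) t2 u2 v2 uv.
have w12 : w1 != w2 by apply: contra neq => /eqP e; rewrite e1 e2 e.
have sumE w : g u w -> g v w -> (\sum_(x in [set u; v; w]) idx x = idx u + idx v + idx w)%N.
  move=> /adj_neq guw /adj_neq gvw.
  rewrite -setUA big_setU1 /=; last by rewrite !inE negb_or uv guw.
  by rewrite big_setU1 /= ?big_set1 ?addnA // inE.
(* Equal colours of uvw1 and uvw2 cancel to equal indices modulo m, hence equal indices. Then w1 and
   w2 share a clique, and u, v, w1, w2 span a K4. *)
have : idx w1 = idx w2.
  have := congr1 val (etrans c1 (esym c2)).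
  rewrite /= e1 e2 !sumE // => /eqP; rewrite eqn_modDl !modn_small //.
  by move/eqP.
move=> /idx_adj /(_ w12) gw.
by have := @hK4 u v w1 w2; apply.
Qed.
End Packing.

(** * From nonnegative excess to the packing bound *)

Theorem theorem1 (V : finType) (g : rel V)
  (gsym : symmetric g) (girr : irreflexive g) (hK4 : K4_free g) :
  let n := #|V| in
  let e := #|edges g| in
  let k : rat := (e%:R - (n ^ 2)%:R / 4%:R)%R in
  exists F : {set {set V}},
    edge_disjoint_triangles g F /\ (Num.ceil k <= (#|F| : int))%R.
Proof.
move=> n e k.
have [Ts [W [pT hT tfW]]] := triangle_partition girr (enum_uniq V).
have uW : uniq W by move: (enum_uniq V); rewrite (perm_uniq pT) cat_uniq => /and3P[].
have [Es [Ss [pE hE ind]]] := edge_partition girr uW.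
have pV : perm_eq (enum V) (flatten Ts ++ flatten Es ++ Ss).
  by apply: perm_trans pT _; rewrite perm_cat2l.
have tf : triangle_free g (flatten Es ++ Ss).
  by apply: sub_triangle_free tfW => x; rewrite (perm_mem pE).
pose cs := Ts ++ Es ++ singles Ss.
have hm : size cs = (size Ts + size Es + size Ss)%N by rewrite !size_cat size_map addnA.
have := excess_ge0 gsym girr hK4 hT hE tf ind.
rewrite -(perm_excess _ _ pV) -hm /excess -cardE => hex.
(* Without cliques there are no colours; the graph is empty and [k = 0]. *)
have [m0|m0] := posnP (size cs).
  have n0 : n = 0%N.
    rewrite /n cardE (perm_size pV); move: hm; rewrite m0 => /esym/eqP.
    by rewrite !addn_eq0 => /andP[/andP[/nilP -> /nilP ->] /nilP ->].
  have noV (x : V) : False by have := card0_eq n0 x; rewrite inE.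
  have e0 : e = 0%N.
    apply/eqP; rewrite cards_eq0; apply/eqP/setP => E; rewrite !inE.
    by apply/negbTE/negP => /existsP[x _]; case: (noV x).
  have k0 : k = 0 by rewrite /k e0 n0 exp0n // mulr0n mul0r subr0.
  exists set0; rewrite cards0 k0 ceil0; split=> //.
  by split=> [|T1 T2]; rewrite ?sub0set ?inE.
have cover x : x \in flatten cs.
  by rewrite !flatten_cat /singles flatten_map1 map_id -(perm_mem pV) mem_enum.
have clq : {in cs, forall P : seq V, {in P &, forall x y, x != y -> g x y}}.
  move=> P; rewrite !mem_cat => /or3P[/(allP hT)|/(allP hE)|/mapP[s _ ->]].
  - case: P => [|a [|b [|c []]]] //= /and3P[ab bc ac] x y; rewrite !inE.
    move=> /or3P[]/eqP -> /or3P[]/eqP ->; rewrite ?eqxx // => _.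
    1-3: by rewrite gsym.
  - case: P => [|a [|b []]] //= ab x y; rewrite !inE.
    move=> /orP[]/eqP -> /orP[]/eqP ->; rewrite ?eqxx // => _.
    by rewrite gsym.
  - by move=> x y; rewrite !inE => /eqP -> /eqP ->; rewrite eqxx.
have [F [disj hF]] := large_packing gsym girr hK4 m0 cover clq.
exists F; split=> //.
have mpos : 0 < (size cs)%:R :> int by rewrite ltr0n.
(* The integer form of [k <= #|F|], obtained by cancelling the number of cliques. *)
have le4 : (4 * e)%N%:R <= (4 * #|F| + n ^ 2)%N%:R :> int.
  have hF' : (#|triangles g|)%:R <= (size cs)%:R * (#|F|)%:R :> int by rewrite -natrM ler_nat.
  have := tri_le girr; have := arcs_ge gsym girr; rewrite -/e => ha ht.
  have ha' := ler_wpM2l (ltW mpos) ha.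
  rewrite -(ler_pM2l mpos) !(natrD, natrM, natrX) -/n.
  exact: packing_arith hex ha' ht hF'.
rewrite ceil_le_int /k.
move: le4; rewrite ler_nat -(ler_nat rat) !(natrD, natrM) => le4.
rewrite -[_%:~R]/(#|F|%:R); lra.
Qed.
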